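(* If a sequent $A \vdash_{\mathsf{L}} B$ is valid in every $\mathtt{SkMBiCA}$ model (i.e. $v(A)\subseteq v(B)$ in every model), then it is derivable in $\mathtt{SkMBiCA}$.
   Context: Formulae are generated by $A,B ::= X \mid \mathsf{I} \mid A \otimes^{\mathsf{L}} B \mid A \multimap^{\mathsf{L}} B \mid A \otimes^{\mathsf{R}} B \mid A \multimap^{\mathsf{R}} B$, with $X$ ranging over a set of atoms. $\mathtt{SkMBiCA}$ has sequents $A \vdash_{\mathsf{L}} B$ generated by: (id) $A\vdash_{\mathsf{L}} A$; (comp) from $A \vdash_{\mathsf{L}} B$ and $B \vdash_{\mathsf{L}} C$ infer $A \vdash_{\mathsf{L}} C$; ($\otimes^{\mathsf{L}}$) from $A\vdash_{\mathsf{L}} C$, $B \vdash_{\mathsf{L}} D$ infer $A\otimes^{\mathsf{L}} B \vdash_{\mathsf{L}} C \otimes^{\mathsf{L}} D$; ($\multimap^{\mathsf{L}}$) from $C \vdash_{\mathsf{L}} A$, $B \vdash_{\mathsf{L}} D$ infer $A\multimap^{\mathsf{L}} B \vdash_{\mathsf{L}} C\multimap^{\mathsf{L}} D$; ($\multimap^{\mathsf{R}}$) from $C \vdash_{\mathsf{L}} A$, $B \vdash_{\mathsf{L}} D$ infer $A\multimap^{\mathsf{R}} B \vdash_{\mathsf{L}} C\multimap^{\mathsf{R}} D$; axioms ($\lambda$) $\mathsf{I}\otimes^{\mathsf{L}} A \vdash_{\mathsf{L}} A$, ($\rho$) $A \vdash_{\mathsf{L}} A \otimes^{\mathsf{L}}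 \mathsf{I}$, ($\alpha$) $(A\otimes^{\mathsf{L}} B)\otimes^{\mathsf{L}} C \vdash_{\mathsf{L}} A \otimes^{\mathsf{L}}(B\otimes^{\mathsf{L}} C)$, ($\gamma$) $A \otimes^{\mathsf{L}} B \vdash_{\mathsf{L}} B \otimes^{\mathsf{R}} A$, ($\gamma^{-1}$) $A \otimes^{\mathsf{R}} B \vdash_{\mathsf{L}} B \otimes^{\mathsf{L}} A$; bidirectional rules ($\pi$) $A \vdash_{\mathsf{L}} B \multimap^{\mathsf{L}} C$ iff $A \otimes^{\mathsf{L}} B \vdash_{\mathsf{L}} C$, ($\pi^{\mathsf{R}}$) $A \vdash_{\mathsf{L}} B \multimap^{\mathsf{R}} C$ iff $A \otimes^{\mathsf{R}} B \vdash_{\mathsf{L}} C$. A $\mathtt{SkMBiCA}$ frame is $\langle W,\leq,\mathbb{I},\mathbb{L},\mathbb{R}\rangle$ with $W$ a set, $\le$ a preorder, $\mathbb{I}\subseteq W$ downward closed, $\mathbb{L},\mathbb{R}\subseteq W^3$ upward closed in their first two arguments and downward closed in their third, satisfying: ($\mathbb{LR}$-reverse) $\mathbb{L}abc \iff \mathbb{R}bac$; (LSA) if $\mathbb{L}abx$ and $\mathbb{L}xcd$ then there is $y$ with $\mathbb{L}bcy$ and $\mathbb{L}ayd$; (LSLU) for $a,b\in W$, $e\in\mathbb{I}$, $\mathbb{L}eab$ implies $b\le a$; (LSRU) for every $a$ there is $e\in\mathbb{I}$ with $\mathbb{L}aea$. A valuation is a map $v$ from formulae to downward closed subsets of $W$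 with $v(\mathsf{I})=\mathbb{I}$, $v(A\otimes^{\mathsf{L}} B) = \{c : \exists a\in v(A), b\in v(B), \mathbb{L}abc\}$, $v(A\multimap^{\mathsf{L}} B)=\{c : \forall a\in v(A), b\in W, \mathbb{L}cab \Rightarrow b\in v(B)\}$, and analogously for $\otimes^{\mathsf{R}},\multimap^{\mathsf{R}}$ with $\mathbb{R}$. A $\mathtt{SkMBiCA}$ model is a $\mathtt{SkMBiCA}$ frame with a valuation. *)

(* Defs.v *)
From Stdlib Require Import RelationClasses.

Set Implicit Arguments.
Unset Strict Implicit.

Inductive formula (At : Type) : Type :=
| Atom : At -> formula At
| Unit : formula At
| TensorL : formula At -> formula At -> formula At
| LolliL : formula At -> formula At -> formula At
| TensorR : formula At -> formula At -> formula At
| LolliR : formula At -> formula At -> formula At.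

Arguments Unit {At}.

Declare Scope skmbica_scope.
Delimit Scope skmbica_scope with skmbica.
Open Scope skmbica_scope.

Notation "A ⊗ᴸ B" := (TensorL A B) (at level 40, left associativity) : skmbica_scope.
Notation "A ⊗ᴿ B" := (TensorR A B) (at level 40, left associativity) : skmbica_scope.
Notation "A ⊸ᴸ B" := (LolliL A B) (at level 41, right associativity) : skmbica_scope.
Notation "A ⊸ᴿ B" := (LolliR A B) (at level 41, right associativity) : skmbica_scope.

Reserved Notation "A ⊢ᴸ B" (at level 70, no associativity).

(* There is deliberately no monotonicity rule for [TensorR]: it is derivable
   from the one for [TensorL] through [d_gamma] and [d_gamma_inv]. *)
Inductive derivable (At : Type) : formula At -> formula At -> Prop :=
| d_id A : A ⊢ᴸ A
| d_comp A B C : A ⊢ᴸ B -> B ⊢ᴸ C -> A ⊢ᴸ C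
| d_tensorL A B C D : A ⊢ᴸ C -> B ⊢ᴸ D -> A ⊗ᴸ B ⊢ᴸ C ⊗ᴸ D
| d_lolliL A B C D : C ⊢ᴸ A -> B ⊢ᴸ D -> A ⊸ᴸ B ⊢ᴸ C ⊸ᴸ D
| d_lolliR A B C D : C ⊢ᴸ A -> B ⊢ᴸ D -> A ⊸ᴿ B ⊢ᴸ C ⊸ᴿ D
| d_lambda A : Unit ⊗ᴸ A ⊢ᴸ A
| d_rho A : A ⊢ᴸ A ⊗ᴸ Unit
| d_alpha A B C : (A ⊗ᴸ B) ⊗ᴸ C ⊢ᴸ A ⊗ᴸ (B ⊗ᴸ C)
| d_gamma A B : A ⊗ᴸ B ⊢ᴸ B ⊗ᴿ A
| d_gamma_inv A B : A ⊗ᴿ B ⊢ᴸ B ⊗ᴸ A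
| d_pi A B C : A ⊗ᴸ B ⊢ᴸ C -> A ⊢ᴸ B ⊸ᴸ C
| d_pi_inv A B C : A ⊢ᴸ B ⊸ᴸ C -> A ⊗ᴸ B ⊢ᴸ C
| d_piR A B C : A ⊗ᴿ B ⊢ᴸ C -> A ⊢ᴸ B ⊸ᴿ C
| d_piR_inv A B C : A ⊢ᴸ B ⊸ᴿ C -> A ⊗ᴿ B ⊢ᴸ C
where "A ⊢ᴸ B" := (derivable A B) : skmbica_scope.

Definition down_closed (W : Type) (le : W -> W -> Prop) (P : W -> Prop) : Prop :=
  forall a b, le b a -> P a -> P b.

Definition up_up_down_closed (W : Type) (le : W -> W -> Prop)
    (T : W -> W -> W -> Prop) : Prop :=
  forall a a' b b' c c',
    le a a' -> le b b' -> le c' c -> T a b c -> T a' b' c'.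

Record frame : Type := Frame {
  world : Type;
  le : world -> world -> Prop;
  unitW : world -> Prop;
  relL : world -> world -> world -> Prop;
  relR : world -> world -> world -> Prop;
  le_preorder : PreOrder le;
  unitW_down : down_closed le unitW;
  relL_closed : up_up_down_closed le relL;
  relR_closed : up_up_down_closed le relR;
  LR_reverse : forall a b c, relL a b c <-> relR b a c;
  LSA : forall a b c d x, relL a b x -> relL x c d ->
          exists y, relL b c y /\ relL a y d;
  LSLU : forall a b e, unitW e -> relL e a b -> le b a;
  LSRU : forall a, exists e, unitW e /\ relL a e a
}.

Record valuation (At : Type) (F : frame) : Type := Valuation {
  val :> formula At -> world F -> Prop;
  val_down : forall A, down_closed (@le F) (val A);
  val_unit : forall c, val Unit c <-> @unitW F c;
  val_tensorL : forall A B c, val (A ⊗ᴸ B) c <->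
    exists a b, val A a /\ val B b /\ relL a b c;
  val_lolliL : forall A B c, val (A ⊸ᴸ B) c <->
    forall a b, val A a -> relL c a b -> val B b;
  val_tensorR : forall A B c, val (A ⊗ᴿ B) c <->
    exists a b, val A a /\ val B b /\ relR a b c;
  val_lolliR : forall A B c, val (A ⊸ᴿ B) c <->
    forall a b, val A a -> relR c a b -> val B b
}.

Record model (At : Type) : Type := Model {
  model_frame : frame;
  model_val : valuation At model_frame
}.

Definition holds_in (At : Type) (M : model At) (A B : formula At) : Prop :=
  forall w : world (model_frame M), model_val M A w -> model_val M B w.

Definition valid (At : Type) (A B : formula At) : Prop :=
  forall M : model At, holds_in M A B.

(* Main.v *)
Require Import Defs.

(** Completeness by the canonical model: worlds are formulae, [C] lies below
    [A] when [C ⊢ᴸ A], and every formula [A] is interpreted by the principal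
    down-set of its entailers.  Evaluating validity of [A ⊢ᴸ B] at the world [A]
    gives derivability. *)

(** Conjugating [d_tensorL] by the swaps [d_gamma_inv] and [d_gamma] exchanges the factors, so the
    premises enter in reverse order. *)
Lemma derivable_tensorR {At : Type} {A B C D : formula At} :
  A ⊢ᴸ C -> B ⊢ᴸ D -> A ⊗ᴿ B ⊢ᴸ C ⊗ᴿ D.
Proof.
  intros hAC hBD.
  exact (d_comp (d_gamma_inv A B) (d_comp (d_tensorL hBD hAC) (d_gamma D C))).
Qed.

(** With [C] related to [A] and [B] when it lies below their tensor, [LR_reverse] reflects γ and its
    inverse, [LSA] α, [LSLU] λ and [LSRU] ρ. *)
Definition canonical_frame (At : Type) : frame.
Proof.
  refine (@Frame (formula At) (@derivable At)
            (fun A => A ⊢ᴸ Unit)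
            (fun A B C => C ⊢ᴸ A ⊗ᴸ B)
            (fun A B C => C ⊢ᴸ A ⊗ᴿ B) _ _ _ _ _ _ _ _).
  - split; [exact (@d_id At) | exact (@d_comp At)].
  - intros a b hba ha. exact (d_comp hba ha).
  - intros a a' b b' c c' ha hb hc h.
    exact (d_comp hc (d_comp h (d_tensorL ha hb))).
  - intros a a' b b' c c' ha hb hc h.
    exact (d_comp hc (d_comp h (derivable_tensorR ha hb))).
  - intros a b c; split; intros h.
    + exact (d_comp h (d_gamma a b)).
    + exact (d_comp h (d_gamma_inv b a)).
  (* [b ⊗ᴸ c] is the greatest world [y] with [relL b c y]. *)
  - intros a b c d x hx hd. exists (b ⊗ᴸ c). split; [apply d_id|].
    exact (d_comp hd (d_comp (d_tensorL hx (d_id c)) (d_alpha a b c))).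
  - intros a b e he hb.
    exact (d_comp hb (d_comp (d_tensorL he (d_id a)) (d_lambda a))).
  - intros a. exists Unit. split; [apply d_id | apply d_rho].
Defined.

Definition canonical_valuation (At : Type) : valuation At (canonical_frame At).
Proof.
  refine (@Valuation At (canonical_frame At) (fun A C => C ⊢ᴸ A) _ _ _ _ _ _);
    simpl.
  - intros A a b hba ha. exact (d_comp hba ha).
  - reflexivity.
  - intros A B c; split.
    + intros h. exists A, B. repeat split; try apply d_id. exact h.
    + intros (a & b & ha & hb & h). exact (d_comp h (d_tensorL ha hb)).
  - intros A B c; split.
    + intros h a b ha hb.
      exact (d_comp hb (d_comp (d_tensorL (d_id c) ha) (d_pi_inv h))).
    (* Testing [h] at generic worlds suffices: [A] is the greatest in its own down-set, [c ⊗ᴸ A] the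
       greatest related to [c] and [A]. *)
    + intros h. apply d_pi. exact (h A (c ⊗ᴸ A) (d_id _) (d_id _)).
  - intros A B c; split.
    + intros h. exists A, B. repeat split; try apply d_id. exact h.
    + intros (a & b & ha & hb & h). exact (d_comp h (derivable_tensorR ha hb)).
  - intros A B c; split.
    + intros h a b ha hb.
      exact (d_comp hb (d_comp (derivable_tensorR (d_id c) ha) (d_piR_inv h))).
    + intros h. apply d_piR. exact (h A (c ⊗ᴿ A) (d_id _) (d_id _)).
Defined.

Theorem mainTheorem9 (At : Type) (A B : formula At) : valid A B -> A ⊢ᴸ B.
Proof.
  intros h. exact (h (Model (canonical_valuation At)) A (d_id A)).
Qed.
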